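(* Consider the strongly convex quadratic problem $\min_{x\in\mathbb{R}^d} f(x)$, $f(x)=\frac12x^\top Ax-b^\top x$, with $A\succ0$. Denote by $m>0$ the least eigenvalue of $A$. Consider applying the Heavy Ball flow (with resets) to this problem. Then the total integration time is, in the worst case, $T^{\mathrm{HB}}=\tilde\Omega\left(\frac{1}{\sqrt m}\right)$, where $\tilde\Omega(\cdot)$ hides the log factor $\log\left(\frac{\|x_1-x_*\|_2}{\epsilon}\right)$. On the other hand, the total integration time $T^{\mathrm{HD}}=\sum_{k=1}^K\frac{\pi}{2}\frac{1}{\sqrt{r_k^{(K)}}}$ for Frictionless Hamiltonian Descent is $T^{\mathrm{HD}}=\tilde\Theta\left(\frac{1}{\sqrt m}\right)$ asymptotically, where $\tilde\Theta(\cdot)$ hides the log factor $\log\left(\frac{2\|x_1-x_*\|_2}{\epsilon}\right)$.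
   Context: $A\in\mathbb{R}^{d\times d}$ is symmetric positive definite, $b\in\mathbb{R}^d$, $x_*=A^{-1}b$ is the minimizer of $f$, $m=\lambda_{\min}(A)$, $L=\lambda_{\max}(A)$, $\kappa=L/m$. $x_1$ is the initial point and $\epsilon>0$ is the target accuracy: the total integration times are those needed to have $\|x_{K+1}-x_*\|_2\le\epsilon$. The total integration time of a method is the total duration of its flow over $K$ iterations, $T=\sum_{k=1}^K\eta_k$, where $\eta_k$ is the integration time for executing the flow at iteration $k$. Heavy Ball flow: $\ddot x+2\sqrt m\,\dot x+\nabla f(x)=0$. With resets and integration times $\{\eta_k^{\mathrm{HB}}\}_{k=1}^K$ (any scheme), $x_{k+1}$ is the position at time $\eta_k^{\mathrm{HB}}$ of the Heavy Ball flow started at position $x_k$ with zero velocity, and $T^{\mathrm{HB}}=\sum_{k=1}^K\eta_k^{\mathrm{HB}}$. Frictionless Hamiltonian Descent with integration times $\{\eta_k\}_{k=1}^K$: for $k=1,\dots,K$, $x_{k+1}$ is the position at time $\eta_k$ of the solution of $\frac{dx}{dt}=v$, $\frac{dv}{dt}=-\nabla f(x)$ started at position $x_k$ with zero velocity. Here $\eta_k=\frac{\pi}{2}\frac{1}{\sqrt{r_k^{(K)}}}$, where $r_k^{(K)}:=\frac{L+m}{2}-\frac{L-m}{2}\cos\left(\frac{(k-\frac12)\pi}{K}\right)$ for $k=1,\dots,K$. The number of iterations used to reach accuracy $\epsilon$ is $K=\frac{\sqrt\kappa+1}{2}\log\frac{2\|x_1-x_*\|_2}{\epsilon}$, and ''asymptotically''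 refers to $K$ sufficiently large.
   Formalization: The upper bound on the total integration time of Frictionless Hamiltonian Descent carries an extra factor 1+log(L/m): with one constant for all condition numbers it fails, since the asymptotic ratio grows like (1/4)log(16κ). K is rounded up to an integer. *)

(* Defs.v *)
From mathcomp Require Import all_boot all_order all_algebra.
From mathcomp Require Import all_classical all_reals all_analysis.

Set Implicit Arguments.
Unset Strict Implicit.
Unset Printing Implicit Defensive.

Import Order.TTheory GRing.Theory Num.Theory.
Import numFieldNormedType.Exports.

Local Open Scope ring_scope.

Definition norm2 (R : realType) (d : nat) (v : 'cV[R]_d) : R :=
  Num.sqrt (\sum_(i < d) v i 0 ^+ 2).

Definition gradient (R : realType) (d : nat) (f : 'cV[R]_d -> R)
    (x : 'cV[R]_d) : 'cV[R]_d :=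
  \col_(i < d) derive f x (delta_mx i 0).

Definition spd (R : realType) (d : nat) (A : 'M[R]_d) : Prop :=
  A^T = A /\ forall v : 'cV[R]_d, v != 0 -> 0 < (v^T *m A *m v) 0 0.

Definition quadratic (R : realType) (d : nat) (A : 'M[R]_d) (b : 'cV[R]_d)
    (x : 'cV[R]_d) : R :=
  2^-1 * (x^T *m A *m x) 0 0 - (b^T *m x) 0 0.

Definition minimizer (R : realType) (d : nat) (A : 'M[R]_d) (b : 'cV[R]_d)
    : 'cV[R]_d :=
  invmx A *m b.

(* Both predicates are false when [d = 0], so a hypothesis [lambda_min A m]
   also says that the dimension is positive. *)
Definition lambda_min (R : realType) (d : nat) (A : 'M[R]_d) (m : R) : Prop :=
  eigenvalue A m /\ forall a, eigenvalue A a -> m <= a.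

Definition lambda_max (R : realType) (d : nat) (A : 'M[R]_d) (L : R) : Prop :=
  eigenvalue A L /\ forall a, eigenvalue A a -> a <= L.

(* [heavy_ball_flow m f t x y]: [y] is the position at time [t] of the flow
   x'' + 2 sqrt(m) x' + grad f(x) = 0 started at position [x] with zero
   velocity. *)
Definition heavy_ball_flow (R : realType) (d : nat) (m : R)
    (f : 'cV[R]_d -> R) (t : R) (x y : 'cV[R]_d) : Prop :=
  exists X V : R -> 'cV[R]_d,
    [/\ forall s : R, is_derive s (1 : R) X (V s),
        forall s : R, is_derive s (1 : R) V
          (- (2 * Num.sqrt m) *: V s - gradient f (X s)),
        X 0 = x, V 0 = 0 & X t = y].

Definition hamiltonian_flow (R : realType) (d : nat)
    (f : 'cV[R]_d -> R) (t : R) (x y : 'cV[R]_d) : Prop :=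
  exists X V : R -> 'cV[R]_d,
    [/\ forall s : R, is_derive s (1 : R) X (V s),
        forall s : R, is_derive s (1 : R) V (- gradient f (X s)),
        X 0 = x, V 0 = 0 & X t = y].

(* [x 1, ..., x K.+1] are the iterates obtained by restarting [flow] with zero
   velocity [K] times, the k-th run lasting [eta k]; [x 0] and [eta 0] are
   irrelevant. *)
Definition reset_iterates (R : realType) (d : nat)
    (flow : R -> 'cV[R]_d -> 'cV[R]_d -> Prop)
    (K : nat) (eta : nat -> R) (x : nat -> 'cV[R]_d) : Prop :=
  forall k, (1 <= k <= K)%N -> flow (eta k) (x k) (x k.+1).

Definition total_time (R : realType) (K : nat) (eta : nat -> R) : R :=
  \sum_(1 <= k < K.+1) eta k.

Definition cheb_root (R : realType) (m L : R) (K k : nat) : R :=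
  (L + m) / 2 - (L - m) / 2 * cos ((k%:R - 2^-1) * pi / K%:R).

Definition hd_time (R : realType) (m L : R) (K k : nat) : R :=
  pi / 2 * (Num.sqrt (cheb_root m L K k))^-1.

Definition hd_iterations (R : realType) (kappa dist eps : R) : R :=
  (Num.sqrt kappa + 1) / 2 * ln (2 * dist / eps).

(* Main.v *)
(** In an eigendirection of [A] both flows are scalar linear equations.  The heavy
    ball flow is critically damped in the direction of [m]: it multiplies the
    error by [(1 + sqrt m t) exp(- sqrt m t) >= exp(- sqrt m t)], so no choice
    of resets beats the total time [ln(dist / eps) / sqrt m].  The frictionless
    flow multiplies the error in the direction of [l] by [cos(sqrt l t)], and
    [|cos(pi/2 y)| <= |1 - y^2|] bounds the product of these cosines by
    [|T_K(s)| / T_K((L+m)/(L-m))], [T_K] being the Chebyshev polynomial and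
    [s] the affine image of [l] in [-1, 1].  The time bounds come from
    [r_k <= L] and from Jordan's inequality, which gives
    [sqrt r_k >= (sqrt m + sqrt L (k-1/2)/K) / 2] and hence a sum of the
    inverses [1 / sqrt r_k] of order [(K / sqrt L) (1 + ln(L/m))]. *)

Require Import Defs.
From mathcomp Require Import all_boot all_order all_algebra.
From mathcomp Require Import spectral sesquilinear complex.
From mathcomp Require Import ring lra.
From mathcomp Require Import all_classical all_reals all_analysis.

Set Implicit Arguments.
Unset Strict Implicit.
Unset Printing Implicit Defensive.

Import Order.TTheory GRing.Theory Num.Theory.
Import numFieldNormedType.Exports.

Local Open Scope ring_scope.

(** * Eigenframe of a symmetric matrix *)

(* The frame consists of the real and imaginary parts of the rows of the unitary
   matrix that diagonalizes [A] over [R[i]], hence it may contain zero vectors. *)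
Lemma symmetric_eigenframe (R : rcfType) (d : nat) (A : 'M[R]_d) : A^T = A ->
  exists (l : 'I_d * bool -> R) (q : 'I_d * bool -> 'rV[R]_d),
    (forall j, q j *m A = l j *: q j) /\
    forall w : 'cV[R]_d,
      \sum_j (q j *m w) 0 0 ^+ 2 = \sum_i w i 0 ^+ 2.
Proof.
move=> symA.
pose phi : {rmorphism R -> R[i]} := real_complex R.
pose Ac := map_mx phi A.
have hermA : Ac \is hermsymmx.
  apply: realsym_hermsym.
    apply/is_hermitianmxP.
    apply/matrixP => i j; rewrite expr0 scale1r !mxE /=.
    by rewrite -[in RHS]symA mxE.
  apply/mxOverP => i j; rewrite mxE.
  by apply/Creal_ImP; rewrite -complexIm.
pose P := spectralmx Ac.
have Pu : P \is unitarymx := spectral_unitarymx Ac.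
pose s := spectral_diag Ac.
have sreal k : s 0 k = phi (complex.Re (s 0 k)).
  have /mxOverP/(_ 0 k) := hermitian_spectral_diag_real hermA.
  by move=> h; exact: (esym (RRe_real h)).
have PA : P *m Ac = diag_mx s *m P.
  have /orthomx_spectralP Aeq := hermitian_normalmx hermA.
  rewrite [X in P *m X]Aeq.
  by rewrite !mulmxA mulmxV ?mul1mx// spectral_unit.
have Pij i j : \sum_k P i k * phi (A k j) = phi (complex.Re (s 0 i)) * P i j.
  have /matrixP/(_ i j) := PA; rewrite mul_diag_mx !mxE sreal => <-.
  by apply: eq_bigr => k _; rewrite mxE.
have Resum (F : 'I_d -> R[i]) :
    complex.Re (\sum_k F k) = \sum_k complex.Re (F k).
  by apply: (big_morph (@complex.Re R)) => // -[a b] [c e].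
have Imsum (F : 'I_d -> R[i]) :
    complex.Im (\sum_k F k) = \sum_k complex.Im (F k).
  by apply: (big_morph (@complex.Im R)) => // -[a b] [c e].
have Remul z a : complex.Re (z * phi a) = complex.Re z * a.
  by case: z => x y /=; rewrite mulr0 subr0.
have Immul z a : complex.Im (z * phi a) = complex.Im z * a.
  by case: z => x y /=; rewrite mulr0 add0r.
(* The Boolean selects the real or the imaginary part of a row of [P]. As [A] and its eigenvalues
   are real, each part satisfies the eigenvector equation separately. *)
pose q (j : 'I_d * bool) : 'rV[R]_d :=
  \row_k (if j.2 then complex.Re (P j.1 k) else complex.Im (P j.1 k)).
exists (fun j => complex.Re (s 0 j.1)), q; split.
  move=> [i b]; apply/rowP => j; rewrite !mxE /=.
  have := Pij i j; rewrite [RHS]mulrC => Pe.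
  case: b => /=.
    have := congr1 (@complex.Re R) Pe; rewrite Resum Remul mulrC => <-.
    by apply: eq_bigr => k _; rewrite !mxE Remul.
  have := congr1 (@complex.Im R) Pe; rewrite Imsum Immul mulrC => <-.
  by apply: eq_bigr => k _; rewrite !mxE Immul.
move=> w.
pose wc := map_mx phi w.
have wJ : map_mx (@Num.conj _) wc = wc.
  apply/matrixP => i j; rewrite !mxE.
  by apply/CrealP/Creal_ImP; rewrite -complexIm.
(* For real [w] the two real coordinates are the parts of one complex coordinate of [P *m wc]; their
   squares add up to its squared modulus, and unitarity of [P] then gives the total. *)
have Pq i : (P *m wc) i 0 = phi ((q (i, true) *m w) 0 0)
     + 'i%C * phi ((q (i, false) *m w) 0 0).
  rewrite [LHS]complexE; congr (_%:C%C + _ * _%:C%C).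
    by rewrite !mxE Resum; apply: eq_bigr => k _; rewrite !mxE Remul.
  by rewrite !mxE Imsum; apply: eq_bigr => k _; rewrite !mxE Immul.
have Pn i : phi ((q (i, true) *m w) 0 0 ^+ 2 + (q (i, false) *m w) 0 0 ^+ 2)
   = (P *m wc) i 0 * ((P *m wc) i 0)^*.
  rewrite -normCK -add_Re2_Im2 Pq.
  by congr (_%:C%C); rewrite /= !mulr0 !mul0r !mul1r !subr0 !addr0 !add0r.
have tot : (((P *m wc) ^t*)%sesqui *m (P *m wc)) 0 0 = (wc^T *m wc) 0 0.
  rewrite trmx_mul map_mxM -map_trmx wJ mulmxA.
  rewrite -(mulmxA _ _ P) -invmx_unitary// mulVmx ?mulmx1//.
  exact: spectral_unit.
apply: (@complexI R).
transitivity ((wc^T *m wc) 0 0).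
  rewrite -tot mxE -(pair_bigA _ (fun i c => (q (i, c) *m w) 0 0 ^+ 2)) /=.
  rewrite -[LHS]/(phi _) rmorph_sum; apply: eq_bigr => i _ /=.
  by rewrite big_bool /= Pn !mxE mulrC.
rewrite mxE -[RHS]/(phi _) rmorph_sum; apply: eq_bigr => i _ /=.
by rewrite !mxE rmorphXn expr2.
Qed.

(** * Flows in eigendirections *)

Lemma is_derive_mulmx (R : realType) (d : nat) (q : 'rV[R]_d)
    (X : R -> 'cV[R]_d) (s : R) (X' : 'cV[R]_d) :
  is_derive s (1 : R) X X' ->
  is_derive s (1 : R) (fun t => (q *m X t) 0 0) ((q *m X') 0 0).
Proof.
move=> dX.
have dX1 : derivable X s 1 by case: dX.
have dXi i : is_derive s (1 : R) (fun t => X t i 0) (X' i 0).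
  apply: DeriveDef; first exact: (derivable_mxP X s 1).1.
  have := derive_mx dX1; rewrite derive_val => ->.
  by rewrite mxE.
rewrite mxE (_ : (fun t => _) = \sum_(i < d) (fun t => q 0 i *: X t i 0)).
  exact: is_derive_sum.
by apply/funext => t; rewrite mxE fct_sumE.
Qed.

Lemma quadratic_cvg (R : realType) (f : R -> R) (a g c : R) :
  (forall h, f h = a + h * g + h ^+ 2 * c) ->
  ((fun h => h^-1 *: (f h - a) : R) @ (0 : R)^' --> g)%classic.
Proof.
move=> fE.
have lim : ((fun h => g + h * c) @ (0 : R)^' --> g)%classic.
  rewrite -[X in (_ --> X)%classic]addr0 -[X in g + X](mul0r c).
  apply: cvgD; first exact: cvg_cst.
  by apply: cvgMr_tmp; exact: nbhs_dnbhs.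
apply: cvg_trans lim; apply: near_eq_cvg; near=> h.
have h0 : h != 0 by near: h; exact: nbhs_dnbhs_neq.
by rewrite fE /GRing.scale/=; field.
Unshelve. all: by end_near. Qed.


(** Along a coordinate direction [quadratic] is exactly a polynomial of degree 2 in the step [h], so
    its partial derivative is the linear coefficient. Symmetry merges the two cross terms. *)
Lemma gradient_quadratic (R : realType) (d : nat) (A : 'M[R]_d)
    (b x : 'cV[R]_d) : A^T = A -> gradient (quadratic A b) x = A *m x - b.
Proof.
move=> symA; apply/colP => i; rewrite [LHS]mxE.
set e := delta_mx i 0.
have tr11 (M : 'M[R]_1) : M^T = M.
  by apply/matrixP => u v; rewrite !ord1 mxE.
have addE (M N : 'M[R]_1) : (M + N) 0 0 = M 0 0 + N 0 0 by rewrite mxE.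
have scaleE a (M : 'M[R]_1) : (a *: M) 0 0 = a * M 0 0 by rewrite mxE.
have oppE (M : 'M[R]_1) : (- M) 0 0 = - M 0 0 by rewrite mxE.
have exp h : quadratic A b (h *: e + x) = quadratic A b x
    + h * (e^T *m (A *m x - b)) 0 0 + h ^+ 2 * (2^-1 * (e^T *m A *m e) 0 0).
  rewrite /quadratic [(_ + _)^T]raddfD /= [(h *: e)^T]linearZ /=.
  rewrite !mulmxDl !mulmxDr -!scalemxAl.
  rewrite -!scalemxAr mulmxN.
  have -> : b^T *m e = e^T *m b.
    by rewrite -[LHS]tr11 trmx_mul trmxK.
  have -> : x^T *m A *m e = e^T *m A *m x.
    by rewrite -[LHS]tr11 !trmx_mul trmxK symA mulmxA.
  rewrite !mulmxA !(addE, scaleE, oppE).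
  by field.

have e_dot : (e^T *m (A *m x - b)) 0 0 = (A *m x - b) i 0.
  rewrite mxE (bigD1 i)//= big1 ?addr0.
    by rewrite [e^T _ _]mxE mxE !eqxx mul1r.
  by move=> j /negPf ji; rewrite [e^T _ _]mxE mxE ji mul0r.
rewrite -e_dot.
by apply/cvg_lim => //; exact: quadratic_cvg exp.
Qed.

Lemma is_derive_scaled (R : realType) (f : R -> R) (w s f' : R) :
  is_derive (w * s) (1 : R) f f' ->
  is_derive s (1 : R) (fun t => f (w * t)) (w * f').
Proof.
move=> df; rewrite mulrC.
have dw : is_derive s (1 : R) (fun t => w * t) w.
  apply: trigger_derive.
  by rewrite /GRing.scale/=; ring.
exact: is_derive1_comp.
Qed.

(** In the phase plane with coordinates [w * y] and [z] the motion is a rotation at speed [w].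
    Undoing this rotation gives two first integrals [a] and [b], which determine the solution
    without any uniqueness theorem. *)
Lemma oscillator_solution (R : realType) (y z : R -> R) (w t : R) : w != 0 ->
  (forall s, is_derive s (1 : R) y (z s)) ->
  (forall s, is_derive s (1 : R) z (- (w ^+ 2 * y s))) ->
  z 0 = 0 -> y t = y 0 * cos (w * t).
Proof.
move=> w0 dy dz z0.
have dcos s : is_derive s (1 : R) (fun t => cos (w * t)) (w * - sin (w * s)).
  exact: is_derive_scaled.
have dsin s : is_derive s (1 : R) (fun t => sin (w * t)) (w * cos (w * s)).
  exact: is_derive_scaled.
pose a s := w * (y s * cos (w * s)) - z s * sin (w * s).
pose b s := w * (y s * sin (w * s)) + z s * cos (w * s).
have a_cst s : a s = a 0.
  apply: is_derive_0_is_cst => {}s.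
  apply: trigger_derive; rewrite /GRing.scale /=; ring.
have b_cst s : b s = b 0.
  apply: is_derive_0_is_cst => {}s.
  apply: trigger_derive; rewrite /GRing.scale /=; ring.
have := a_cst t; have := b_cst t.
rewrite /a /b z0 mulr0 cos0 sin0 !(mulr0, mulr1, mul0r, addr0, subr0) => bt at_.
apply: (mulfI w0).
(* Rotating back recovers [w * y t] from the two constants. *)
have -> : w * y t = cos (w * t) * (w * (y t * cos (w * t)) - z t * sin (w * t))
   + sin (w * t) * (w * (y t * sin (w * t)) + z t * cos (w * t)).
  by rewrite -[LHS]mulr1 -(cos2Dsin2 (w * t)); ring.
by rewrite bt at_; ring.
Qed.

(** The characteristic root [- mu] is double: [g], the derivative of [y s * expR (mu * s)], is
    constant, so that product is affine in [s]. *)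
Lemma critical_damping_solution (R : realType) (y z : R -> R) (mu t : R) :
  (forall s, is_derive s (1 : R) y (z s)) ->
  (forall s, is_derive s (1 : R) z (- (2 * mu * z s) - mu ^+ 2 * y s)) ->
  z 0 = 0 -> y t = y 0 * ((1 + mu * t) * expR (- (mu * t))).
Proof.
move=> dy dz z0.
have dexp s : is_derive s (1 : R) (fun t => expR (mu * t)) (mu * expR (mu * s)).
  exact: is_derive_scaled.
pose g s := (z s + mu * y s) * expR (mu * s).
have g_cst s : g s = mu * y 0.
  transitivity (g 0); last by rewrite /g z0 mulr0 expR0 mulr1 add0r.
  apply: is_derive_0_is_cst => {}s.
  apply: trigger_derive; rewrite /GRing.scale /=; ring.
pose h s := y s * expR (mu * s) - (mu * y 0) * s.
have h_cst s : h s = y 0.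
  transitivity (h 0); last by rewrite /h !mulr0 expR0 mulr1 subr0.
  apply: is_derive_0_is_cst => {}s.
  apply: trigger_derive; rewrite -(g_cst s) /g /GRing.scale /=; ring.
have := h_cst t; rewrite /h => ht.
rewrite expRN mulrA -[LHS](mulfK (lt0r_neq0 (expR_gt0 (mu * t)))).
by congr (_ / _); move: ht; lra.
Qed.

Lemma spd_eigenvalue_gt0 (R : realType) (d : nat) (A : 'M[R]_d) (l : R) :
  spd A -> eigenvalue A l -> 0 < l.
Proof.
move=> [_ posA] /eigenvalueP[v vA v0].
have vT0 : v^T != 0 by rewrite trmx_eq0.
have := posA _ vT0; rewrite trmxK vA -scalemxAl mxE.
have vv : 0 <= (v *m v^T) 0 0.
  by rewrite mxE sumr_ge0// => i _; rewrite mxE -expr2 sqr_ge0.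
move=> h; rewrite ltNge; apply/negP => l0.
by move: h; rewrite ltNge mulr_le0_ge0.
Qed.

(** [invmx] returns a singular matrix unchanged, so invertibility has to be established: a nonzero
    kernel vector would make 0 an eigenvalue. *)
Lemma spd_mul_minimizer (R : realType) (d : nat) (A : 'M[R]_d) (b : 'cV[R]_d) :
  spd A -> A *m minimizer A b = b.
Proof.
move=> spdA; rewrite /minimizer mulKVmx// -row_free_unit -kermx_eq0.
apply/negPn/negP => /rowV0Pn[v /sub_kermxP vA v0].
have : eigenvalue A 0 by apply/eigenvalueP; exists v; rewrite ?scale0r.
by move=> /(spd_eigenvalue_gt0 spdA); rewrite ltxx.
Qed.

Lemma eigen_gradient (R : realType) (d : nat) (A : 'M[R]_d) (b x : 'cV[R]_d)
    (q : 'rV[R]_d) (l : R) : spd A -> q *m A = l *: q ->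
  (q *m gradient (quadratic A b) x) 0 0 = l * (q *m (x - minimizer A b)) 0 0.
Proof.
move=> spdA qA; rewrite gradient_quadratic; last by case: spdA.
by rewrite -{1}(spd_mul_minimizer b spdA) -mulmxBr mulmxA qA -scalemxAl mxE.
Qed.

Lemma is_derive_eigencoord (R : realType) (d : nat) (q : 'rV[R]_d)
    (X V : R -> 'cV[R]_d) (c : 'cV[R]_d) (s : R) :
  is_derive s (1 : R) X (V s) ->
  is_derive s (1 : R) (fun t => (q *m (X t - c)) 0 0) ((q *m V s) 0 0).
Proof.
move=> dX; have dXc : is_derive s (1 : R) (fun t => X t - c) (V s).
  by apply: is_derive_eq; rewrite subr0.
exact: is_derive_mulmx.
Qed.

(** The friction [2 * Num.sqrt m] is critical exactly for the eigenvalue [m], so the coordinate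
    along [q] solves the double root equation with [mu] equal to [Num.sqrt m]. *)
Lemma heavy_ball_eigencoord (R : realType) (d : nat) (A : 'M[R]_d)
    (b x y : 'cV[R]_d) (q : 'rV[R]_d) (m t : R) :
  spd A -> 0 <= m -> q *m A = m *: q ->
  heavy_ball_flow m (quadratic A b) t x y ->
  (q *m (y - minimizer A b)) 0 0 = (q *m (x - minimizer A b)) 0 0 *
    ((1 + Num.sqrt m * t) * expR (- (Num.sqrt m * t))).
Proof.
move=> spdA m0 qA [X [V [dX dV <- V0 <-]]].
apply: (@critical_damping_solution _
  (fun s => (q *m (X s - minimizer A b)) 0 0) (fun s => (q *m V s) 0 0)).
- by move=> s; exact: is_derive_eigencoord.
- move=> s; have := is_derive_mulmx q (dV s).
  rewrite mulmxBr -scalemxAr [X in is_derive _ _ _ X]mxE.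
  rewrite [X in X + _]mxE [X in _ + X]mxE (eigen_gradient _ _ spdA qA).
  by rewrite mulNr sqr_sqrtr.
- by rewrite V0 mulmx0 mxE.
Qed.

Lemma hamiltonian_eigencoord (R : realType) (d : nat) (A : 'M[R]_d)
    (b x y : 'cV[R]_d) (q : 'rV[R]_d) (l t : R) :
  spd A -> 0 < l -> q *m A = l *: q ->
  hamiltonian_flow (quadratic A b) t x y ->
  (q *m (y - minimizer A b)) 0 0 = (q *m (x - minimizer A b)) 0 0 *
    cos (Num.sqrt l * t).
Proof.
move=> spdA l0 qA [X [V [dX dV <- V0 <-]]].
apply: (@oscillator_solution _
  (fun s => (q *m (X s - minimizer A b)) 0 0) (fun s => (q *m V s) 0 0)).
- by rewrite gt_eqF// sqrtr_gt0.
- by move=> s; exact: is_derive_eigencoord.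
- move=> s; have := is_derive_mulmx q (dV s).
  rewrite mulmxN [X in is_derive _ _ _ X]mxE (eigen_gradient _ _ spdA qA).
  by rewrite sqr_sqrtr// ltW.
- by rewrite V0 mulmx0 mxE.
Qed.

(** * Restarted flows, Euclidean norms and the heavy ball time bound *)

Lemma reset_iterates_prod (R : realType) (d : nat)
    (flow : R -> 'cV[R]_d -> 'cV[R]_d -> Prop) (u : 'cV[R]_d -> R)
    (factor : R -> R) (K : nat) (eta : nat -> R) (x : nat -> 'cV[R]_d) :
  (forall t y z, flow t y z -> u z = u y * factor t) ->
  reset_iterates flow K eta x ->
  u (x K.+1) = u (x 1%N) * \prod_(1 <= k < K.+1) factor (eta k).
Proof.
move=> flowE; elim: K => [|K IHK] xP; first by rewrite big_geq// mulr1.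
rewrite big_nat_recr//= mulrA -IHK.
  by apply: flowE; apply: xP; rewrite leqnn.
by move=> k /andP[k1 kK]; apply: xP; rewrite k1 leqW.
Qed.

Lemma norm2_sqr (R : realType) (d : nat) (v : 'cV[R]_d) :
  norm2 v ^+ 2 = \sum_i v i 0 ^+ 2.
Proof. by rewrite sqr_sqrtr// sumr_ge0// => i _; rewrite sqr_ge0. Qed.

Lemma norm2_ge0 (R : realType) (d : nat) (v : 'cV[R]_d) : 0 <= norm2 v.
Proof. exact: sqrtr_ge0. Qed.

(** Cauchy-Schwarz: removing from [w] its projection on [q] leaves a vector of squared norm
    [norm2 w ^+ 2 - c ^+ 2], which is nonnegative. *)
Lemma unit_coord_le_norm2 (R : realType) (d : nat) (q w : 'cV[R]_d) :
  norm2 q = 1 -> (q^T *m w) 0 0 <= norm2 w.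
Proof.
move=> q1; apply: le_trans (ler_norm _) _.
rewrite -(ler_pXn2r (n := 2))// ?nnegrE ?norm2_ge0// real_normK ?num_real//.
set c := (q^T *m w) 0 0.
have : 0 <= norm2 (w - c *: q) ^+ 2 by rewrite sqr_ge0.
suff -> : norm2 (w - c *: q) ^+ 2 = norm2 w ^+ 2 - c ^+ 2 by rewrite subr_ge0.
transitivity (norm2 w ^+ 2 - 2 * c * c + c ^+ 2 * norm2 q ^+ 2); last first.
  by rewrite q1; ring.
have cE : c = \sum_i q i 0 * w i 0.
  by rewrite /c mxE; apply: eq_bigr => i _; rewrite mxE.
rewrite {3}cE !norm2_sqr !mulr_sumr -sumrB -big_split /=.
by apply: eq_bigr => i _; rewrite !mxE; ring.
Qed.

Lemma unit_eigenvector (R : realType) (d : nat) (A : 'M[R]_d) (l : R) :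
  eigenvalue A l -> exists q : 'cV[R]_d, norm2 q = 1 /\ q^T *m A = l *: q^T.
Proof.
move=> /eigenvalueP[v vA v0].
have n0 : norm2 v^T != 0.
  rewrite -sqrf_eq0 norm2_sqr; apply: contra v0 => /eqP.
  move/psumr_eq0P => h; apply/eqP/rowP => i; rewrite mxE.
  apply/eqP; rewrite -sqrf_eq0; have := h _ i isT; rewrite mxE => ->//.
  by move=> j _; rewrite sqr_ge0.
exists ((norm2 v^T)^-1 *: v^T); split.
  apply/eqP; rewrite -(eqrXn2 (n := 2))// ?norm2_ge0// expr1n norm2_sqr.
  under eq_bigr do rewrite mxE exprMn.
  by rewrite -mulr_sumr -norm2_sqr exprVn mulVf// expf_neq0.
by rewrite linearZ/= trmxK -scalemxAl vA scalerA mulrC -scalerA.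
Qed.

Lemma heavy_ball_total_time (R : realType) (d : nat) (A : 'M[R]_d)
    (b : 'cV[R]_d) (m dist : R) (q : 'cV[R]_d) (eps : R) (K : nat)
    (eta : nat -> R) (x : nat -> 'cV[R]_d) :
  spd A -> 0 < m -> norm2 q = 1 -> q^T *m A = m *: q^T -> 0 < dist ->
  0 < eps -> (forall k, (1 <= k <= K)%N -> 0 <= eta k) ->
  x 1%N = minimizer A b + dist *: q ->
  reset_iterates (heavy_ball_flow m (quadratic A b)) K eta x ->
  norm2 (x K.+1 - minimizer A b) <= eps ->
  (Num.sqrt m)^-1 * ln (dist / eps) <= total_time K eta.
Proof.
move=> spdA m0 q1 qA dist0 eps0 eta0 x1E xP xeps.
have sm0 : 0 < Num.sqrt m by rewrite sqrtr_gt0.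
have /(reset_iterates_prod)-/(_ _ _ _ xP) := fun t y z =>
  @heavy_ball_eigencoord R d A b y z q^T m t spdA (ltW m0) qA.
have -> : (q^T *m (x 1%N - minimizer A b)) 0 0 = dist.
  rewrite x1E addrC addKr -scalemxAr mxE mxE -[RHS]mulr1; congr (_ * _).
  rewrite -[RHS](expr1n _ 2) -q1 norm2_sqr.
  by apply: eq_bigr => i _; rewrite mxE expr2.
move=> prodE.
(* Dropping the factors [1 + Num.sqrt m * eta k], which are at least 1 for nonnegative times, leaves
   exponentials whose exponents add up to the total time. *)
have expT : dist * expR (- (Num.sqrt m * total_time K eta)) <= eps.
  apply: le_trans xeps; apply: le_trans (unit_coord_le_norm2 _ q1).
  rewrite prodE ler_pM2l// /total_time mulr_sumr -sumrN expR_sum.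
  rewrite [leLHS]big_nat_cond [leRHS]big_nat_cond.
  apply: ler_prod => k; rewrite andbT => kK.
  rewrite expR_ge0 /= ler_peMl ?expR_ge0//.
  by rewrite lerDl mulr_ge0 ?eta0// ltW.
rewrite mulrC ler_pdivrMr// [leRHS]mulrC -ler_expR lnK ?posrE ?divr_gt0//.
rewrite ler_pdivrMr// [leRHS]mulrC.
by move: expT; rewrite expRN ler_pdivrMr ?expR_gt0.
Qed.

(** * Trigonometric inequalities *)

Lemma mul_cos_le_sin (R : realType) (x : R) :
  0 <= x <= pi -> x * cos x <= sin x.
Proof.
move=> /andP[x0 xpi].
pose f (t : R) := sin t - t * cos t.
have df (t : R) : is_derive t (1 : R) f (t * sin t).
  by apply: trigger_derive; rewrite /GRing.scale/=; ring.
suff : f 0 <= f x by rewrite /f sin0 mul0r subr0 subr_ge0.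
apply: (@ger0_derive1_le_cc _ f 0 pi); rewrite ?in_itv/= ?lexx ?pi_ge0 ?x0//.
- move=> t /itvP tpi; rewrite derive1E derive_val mulr_ge0 ?tpi//.
  by rewrite sin_ge0_pi// !tpi.
- by apply: derivable_within_continuous.
Qed.

(** The derivative of [sin t / t] has the sign of [t * cos t - sin t], which is nonpositive up to
    [pi]. *)
Lemma sin_div_nincr (R : realType) (x y : R) : 0 < x -> x <= y -> y <= pi ->
  x * sin y <= y * sin x.
Proof.
move=> x0 xy ypi.
have y0 : 0 < y by exact: lt_le_trans xy.
pose f (t : R) := sin t / t.
have df (t : R) : 0 < t -> is_derive t (1 : R) f ((t * cos t - sin t) / t ^+ 2).
  move=> t0; have tn0 : t != 0 by rewrite gt_eqF.
  have dV : is_derive t (1 : R) (fun u : R => u^-1) (- t ^- 2 *: 1).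
    by apply: (@is_deriveV _ id).
  by apply: trigger_derive; rewrite /GRing.scale/=; field.
suff : f y <= f x.
  by rewrite /f ler_pdivrMr// mulrAC ler_pdivlMr// mulrC [leRHS]mulrC.
apply: (@ler0_derive1_le_cc _ f x y); rewrite ?in_itv/= ?lexx ?xy//.
- move=> t /itvP txy; have /df[]// : 0 < t by rewrite (lt_trans x0)// txy.
- move=> t /itvP txy; have t0 : 0 < t by rewrite (lt_trans x0)// txy.
  have dft := df t t0; rewrite derive1E derive_val.
  rewrite pmulr_lle0 ?invr_gt0 ?exprn_gt0// subr_le0 mul_cos_le_sin//.
  by rewrite ltW//= (le_trans _ ypi)// txy.
- apply: derivable_within_continuous => t; rewrite inE/= => /itvP txy.
  by have /df[] : 0 < t by rewrite (lt_le_trans x0)// txy.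
Qed.

(** This compares the sine with its chord up to [pi / 2]; the point 0 is split off because the
    quotient [sin t / t] is only controlled for positive [t]. *)
Lemma jordan_sin (R : realType) (x : R) :
  0 <= x <= 1 -> x <= sin (x * (pi / 2)).
Proof.
move=> /andP[]; rewrite le_eqVlt => /predU1P[<- _|x0 x1].
  by rewrite mul0r sin0.
have p2 : 0 < pi / 2 :> R by rewrite divr_gt0 ?pi_gt0.
have : x * (pi / 2) * sin (pi / 2) <= pi / 2 * sin (x * (pi / 2)).
  apply: sin_div_nincr; first by rewrite mulr_gt0.
    by rewrite ler_piMl// ltW.
  by rewrite ler_pdivrMr// ler_peMr ?pi_ge0// ler1n.
by rewrite sin_pihalf mulr1 mulrC ler_pM2l.
Qed.

Lemma sin_piquarter (R : realType) : sin (pi / 4 : R) ^+ 2 = 2^-1.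
Proof.
have := cos_pihalf R.
have -> : pi / 2 = (pi / 4) *+ 2 :> R by rewrite mulr2n; field.
by rewrite cos_mulr2n cos2sin2; lra.
Qed.

Lemma cos_pihalf_sin2 (R : realType) (y : R) :
  cos (pi / 2 * y) = 1 - 2 * sin (pi / 4 * y) ^+ 2.
Proof.
have -> : pi / 2 * y = (pi / 4 * y) *+ 2 :> R by rewrite mulr2n; field.
by rewrite cos_mulr2n cos2sin2; ring.
Qed.

(* By [cos (pi/2 y) = 1 - 2 sin^2 (pi/4 y)] this compares [sin (pi/4 y)] with its
   chord [y sin (pi/4)], which the monotonicity of [sin t / t] does. *)
Lemma norm_cos_pihalf_le (R : realType) (y : R) : 0 <= y ->
  `|cos (pi / 2 * y)| <= `|1 - y ^+ 2|.
Proof.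
have p0 := pi_gt0 R.
have p4 : 0 < pi / 4 :> R by rewrite divr_gt0.
rewrite le_eqVlt => /predU1P[<-|y0]; first by rewrite mulr0 cos0 expr0n subr0.
have py : 0 < pi * y := mulr_gt0 p0 y0.
have s4 := sin_piquarter R.
have [y1|y1] := leP y 1.
  (* This product gives [lra] the nonlinear fact it needs, with [pi * y] treated as an atom. *)
  have py1 : 0 <= pi * (1 - y) by rewrite mulr_ge0 ?subr_ge0// ltW.
  have c0 : 0 <= cos (pi / 2 * y).
    by apply: cos_ge0_pihalf; apply/andP; split; lra.
  have y21 : y ^+ 2 <= 1 by rewrite expr_le1// ltW.
  rewrite !ger0_norm ?subr_ge0// cos_pihalf_sin2 lerD2l lerN2.
  have h : pi / 4 * y * sin (pi / 4) <= pi / 4 * sin (pi / 4 * y).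
    by apply: sin_div_nincr; lra.
  have {}h : y * sin (pi / 4) <= sin (pi / 4 * y).
    by rewrite -(ler_pM2l p4) mulrA.
  have sp : 0 <= sin (pi / 4 : R) by apply: sin_ge0_pi; apply/andP; split; lra.
  have h0 : 0 <= y * sin (pi / 4) by apply: mulr_ge0 sp; exact: ltW.
  have := ler_pM h0 h0 h h; rewrite mulrACA -!expr2 s4; lra.
(* From 2 on, [y ^+ 2 - 1] is at least 3 and the trivial bound on the cosine suffices. Between 1 and
   2 the cosine is nonpositive and the comparison with the chord is reversed. *)
have [y2|y2] := leP 2 y.
  apply: le_trans (cos_max _) _.
  rewrite distrC ger0_norm; nra.
have py1 : 0 < pi * (y - 1) by rewrite mulr_gt0 ?subr_gt0.
have py2 : 0 < pi * (2 - y) by rewrite mulr_gt0 ?subr_gt0.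
have c0 : cos (pi / 2 * y) <= 0.
  have -> : pi / 2 * y = (pi / 2 * y - pi / 2) + pi / 2 by ring.
  rewrite cosDpihalf oppr_le0; apply: sin_ge0_pi; apply/andP; split; lra.
rewrite ler0_norm// distrC ger0_norm; last by rewrite subr_ge0 expr_ge1// ltW.
rewrite cos_pihalf_sin2 opprB lerD2r.
have h : pi / 4 * sin (pi / 4 * y) <= pi / 4 * y * sin (pi / 4).
  by apply: sin_div_nincr; lra.
have {}h : sin (pi / 4 * y) <= y * sin (pi / 4).
  by rewrite -(ler_pM2l p4) mulrA.
have h0 : 0 <= sin (pi / 4 * y) by apply: sin_ge0_pi; apply/andP; split; lra.
by have := ler_pM h0 h0 h h; rewrite mulrACA -!expr2 s4; lra.
Qed.

(** * Chebyshev polynomials *)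

Fixpoint chebyshevT (R : nzRingType) (n : nat) : {poly R} :=
  if n is n1.+1 then
    if n1 is n2.+1 then 2 *: (chebyshevT R n1 * 'X) - chebyshevT R n2 else 'X
  else 1.

(** The recurrence is the sum formula for the cosines of [n.+1 * x + x] and [n.+1 * x - x]. It
    reaches back two indices, so the induction carries two consecutive ones. *)
Lemma chebyshevT_cos (R : realType) (n : nat) (x : R) :
  (chebyshevT R n).[cos x] = cos (n%:R * x).
Proof.
suff [] : (chebyshevT R n).[cos x] = cos (n%:R * x) /\
  (chebyshevT R n.+1).[cos x] = cos (n.+1%:R * x) by [].
elim: n => [|n [IH0 IH1]]; first by rewrite hornerC hornerX mul0r mul1r cos0.
split=> //.
rewrite -[chebyshevT R n.+2]/(2 *: (chebyshevT R n.+1 * 'X) - chebyshevT R n).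
rewrite !hornerE /= IH1 IH0.
have -> : n.+2%:R * x = n.+1%:R * x + x by rewrite -natr1 mulrDl mul1r.
have -> : n%:R * x = n.+1%:R * x - x by rewrite -natr1 mulrDl mul1r addrK.
by rewrite !cosD cosN sinN /=; ring.
Qed.

Lemma chebyshevT_joukowski (R : numFieldType) (n : nat) (z : R) : z != 0 ->
  (chebyshevT R n).[(z + z^-1) / 2] = (z ^+ n + z ^- n) / 2.
Proof.
move=> z0.
suff [] : (chebyshevT R n).[(z + z^-1) / 2] = (z ^+ n + z ^- n) / 2 /\
  (chebyshevT R n.+1).[(z + z^-1) / 2] = (z ^+ n.+1 + z ^- n.+1) / 2 by [].
elim: n => [|n [IH0 IH1]].
  by rewrite hornerC hornerX expr0 invr1 expr1; split=> //; field.
split=> //.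
rewrite -[chebyshevT R n.+2]/(2 *: (chebyshevT R n.+1 * 'X) - chebyshevT R n).
rewrite !hornerE /= IH1 IH0 !exprS; field.
by rewrite expf_neq0.
Qed.

Lemma size_chebyshevT (R : numFieldType) (n : nat) :
  size (chebyshevT R n) = n.+1.
Proof.
suff [] : size (chebyshevT R n) = n.+1 /\ size (chebyshevT R n.+1) = n.+2 by [].
elim: n => [|n [IH0 IH1]]; first by rewrite size_poly1 size_polyX.
split=> //.
rewrite -[chebyshevT R n.+2]/(2 *: (chebyshevT R n.+1 * 'X) - chebyshevT R n).
have sz : size (2 *: (chebyshevT R n.+1 * 'X)) = n.+3.
  rewrite size_scale ?pnatr_eq0// size_mulX ?IH1//.
  by rewrite -size_poly_gt0 IH1.
by rewrite size_polyDl sz// size_polyN IH0.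
Qed.

(** For [k] from 1 to [K] these are the zeros of the Chebyshev polynomial of degree [K];
    [cheb_root m L K k] is the image of the node under the affine map sending 1 to [m] and -1 to
    [L]. *)
Definition cheb_node (R : realType) (K k : nat) : R :=
  cos ((k%:R - 2^-1) * pi / K%:R).

Lemma chebyshevT_root (R : realType) (K k : nat) : (0 < K)%N ->
  root (chebyshevT R K) (cheb_node R K k).
Proof.
move=> K0; rewrite /root chebyshevT_cos.
have -> : K%:R * ((k%:R - 2^-1) * pi / K%:R) = k%:R * pi - pi / 2 :> R.
  by field; rewrite pnatr_eq0 -lt0n.
rewrite cosBpihalf mulr_natl -[pi *+ k]add0r.
by rewrite (alternatingn (@sinDpi R)) sin0 mulr0.
Qed.

(** The [K] nodes are distinct because cosine is injective on [[0, pi]], and there are as many of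
    them as the degree. *)
Lemma chebyshevT_factor (R : realType) (K : nat) (x : R) : (0 < K)%N ->
  (chebyshevT R K).[x] =
  lead_coef (chebyshevT R K) * \prod_(1 <= k < K.+1) (x - cheb_node R K k).
Proof.
move=> K0.
have K0R : 0 < K%:R :> R by rewrite ltr0n.
pose rs := [seq cheb_node R K k | k <- index_iota 1 K.+1].
have arg_in k : k \in index_iota 1 K.+1 ->
    (k%:R - 2^-1) * pi / K%:R \in `[0, (pi : R)].
  rewrite mem_index_iota ltnS in_itv/= => /andP[k1 kK].
  have {}k1 : 1 <= k%:R :> R by rewrite ler1n.
  have {}kK : k%:R <= K%:R :> R by rewrite ler_nat.
  apply/andP; split.
    by apply: divr_ge0; [apply: mulr_ge0; [lra|exact: pi_ge0]|exact: ltW].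
  by rewrite ler_pdivrMr// mulrC ler_wpM2l ?pi_ge0//; lra.
rewrite {1}(@all_roots_prod_XsubC _ (chebyshevT R K) rs).
- rewrite hornerZ /rs big_map horner_prod; congr (_ * _).
  by apply: eq_bigr => k _; rewrite hornerXsubC.
- by rewrite size_chebyshevT size_map size_iota subn1.
- by apply/allP => _ /mapP[k _ ->]; exact: chebyshevT_root.
- rewrite uniq_rootsE map_inj_in_uniq ?iota_uniq// => i j iK jK.
  move=> /(cos_inj (arg_in _ iK) (arg_in _ jK)).
  have K0V : (K%:R^-1 : R) != 0 by rewrite invr_eq0 gt_eqF.
  move=> /(mulIf K0V)/(mulIf (lt0r_neq0 (pi_gt0 R)))/addIr/eqP.
  by rewrite eqr_nat => /eqP.
Qed.

(** Leading coefficients cancel, leaving a quotient of two Chebyshev values: the numerator is a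
    cosine, and the denominator is at least [z ^+ K / 2] once the inverse power is dropped. *)
Lemma chebyshev_prod_ratio (R : realType) (K : nat) (t z : R) : (0 < K)%N ->
  -1 <= t <= 1 -> 1 <= z ->
  `|\prod_(1 <= k < K.+1)
     ((t - cheb_node R K k) / ((z + z^-1) / 2 - cheb_node R K k))| <=
  2 * z ^- K.
Proof.
move=> K0 t1 z1; have z0 : 0 < z by rewrite (lt_le_trans _ z1).
set s := (z + z^-1) / 2.
pose T := chebyshevT R K.
have lc0 : lead_coef T != 0.
  by rewrite lead_coef_eq0 -size_poly_gt0 size_chebyshevT.
rewrite prodf_div.
have -> : (\prod_(1 <= k < K.+1) (t - cheb_node R K k)) /
   (\prod_(1 <= k < K.+1) (s - cheb_node R K k)) = T.[t] / T.[s].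
  by rewrite !chebyshevT_factor// -mulf_div divff// mul1r.
have Tt : `|T.[t]| <= 1.
  by rewrite -(acosK (_ : t \in `[-1, 1])) ?in_itv//= chebyshevT_cos cos_max.
have zK : 0 < z ^+ K by rewrite exprn_gt0.
have Ts : z ^+ K / 2 <= T.[s].
  rewrite /T chebyshevT_joukowski ?gt_eqF// ler_pM2r// lerDl.
  by rewrite invr_ge0 ltW.
have Ts0 : 0 < T.[s] by apply: lt_le_trans Ts; rewrite divr_gt0.
rewrite normrM normfV [`|T.[s]|]gtr0_norm// ler_pdivrMr//.
apply: le_trans Tt _; apply: le_trans (ler_wpM2l _ Ts).
  have -> // : 2 * z ^- K * (z ^+ K / 2) = 1 by field; rewrite gt_eqF.
by rewrite mulr_ge0// invr_ge0 ltW.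
Qed.

(** * Contraction and integration time of Hamiltonian descent *)

Lemma cheb_root_itv (R : realType) (m L : R) (K k : nat) : m <= L ->
  m <= cheb_root m L K k <= L.
Proof.
move=> mL; rewrite /cheb_root; set c := cos _.
have c1 : 0 <= (L - m) * (1 - c) by rewrite mulr_ge0 ?subr_ge0 ?cos_le1.
have c2 : 0 <= (L - m) * (1 + c).
  by rewrite mulr_ge0 ?subr_ge0// -lerBlDl sub0r cos_geN1.
by apply/andP; split; lra.
Qed.

(** The duration is chosen so that the angle is [pi / 2 * y] with [y ^+ 2] equal to
    [l / cheb_root m L K k]. *)
Lemma norm_cos_hd_time_le (R : realType) (m L l : R) (K k : nat) :
  0 < m -> m <= L -> 0 <= l ->
  `|cos (Num.sqrt l * hd_time m L K k)| <= `|1 - l / cheb_root m L K k|.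
Proof.
move=> m0 mL l0; have /andP[mr _] := cheb_root_itv K k mL.
have r0 : 0 <= cheb_root m L K k by rewrite (le_trans (ltW m0)).
set r := cheb_root m L K k in mr r0 *; rewrite /hd_time mulrCA.
have -> : l / r = (Num.sqrt l / Num.sqrt r) ^+ 2.
  by rewrite expr_div_n !sqr_sqrtr.
by apply: norm_cos_pihalf_le; rewrite divr_ge0.
Qed.

Lemma prod_cos_hd_time_le (R : realType) (m L l : R) (K : nat) :
  0 < m -> m <= l -> l <= L -> (0 < K)%N ->
  `|\prod_(1 <= k < K.+1) cos (Num.sqrt l * hd_time m L K k)| <=
  2 * ((Num.sqrt L - Num.sqrt m) / (Num.sqrt L + Num.sqrt m)) ^+ K.
Proof.
move=> m0 ml lL K0.
have l0 : 0 < l := lt_le_trans m0 ml.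
have mL := le_trans ml lL; have L0 := lt_le_trans m0 mL.
apply: (@le_trans _ _ `|\prod_(1 <= k < K.+1) (1 - l / cheb_root m L K k)|).
  rewrite !normr_prod; apply: ler_prod => k _; rewrite normr_ge0/=.
  exact: norm_cos_hd_time_le (ltW _).
have sm0 : 0 < Num.sqrt m by rewrite sqrtr_gt0.
have smE : Num.sqrt m ^+ 2 = m by rewrite sqr_sqrtr// ltW.
have sLE : Num.sqrt L ^+ 2 = L by rewrite sqr_sqrtr// ltW.
(* If [m = L] the affine change of variable degenerates, but then every root equals [l]: the first
   factor vanishes, and so does the right-hand side since [K] is positive. *)
move: mL; rewrite le_eqVlt => /predU1P[mLe|mL].
  rewrite big_ltn// /cheb_root -mLe subrr !mul0r subr0.
  have -> : l = m by apply/eqP; rewrite eq_le ml mLe lL.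
  rewrite -mulr2n -(mulr_natr m) mulfK ?pnatr_eq0// divff ?gt_eqF//.
  rewrite subrr mul0r normr0.
  by rewrite subrr mul0r expr0n gtn_eqF// mulr0.
set a := Num.sqrt m in sm0 smE *; set B := Num.sqrt L in sLE *.
have aB : a < B by rewrite ltr_sqrt.
(* This [z] solves [(z + z^-1) / 2 = (L + m) / (L - m)], the point that the affine change of
   variable assigns to the eigenvalue 0; [t] below is the image of [l]. *)
pose z := (B + a) / (B - a).
have zB : 0 < B - a by rewrite subr_gt0.
have zA : 0 < B + a by rewrite addr_gt0// (lt_trans sm0).
have Lm : 0 < L - m by rewrite subr_gt0.
have -> : (B - a) / (B + a) = z^-1 by rewrite invf_div.
rewrite exprVn.
pose t := (L + m - 2 * l) / (L - m).
have zE : (z + z^-1) / 2 = (L + m) / (L - m).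
  rewrite /z -sLE -smE; field.
  by rewrite sLE smE !gt_eqF.
rewrite (eq_bigr (fun k =>
    (t - cheb_node R K k) / ((z + z^-1) / 2 - cheb_node R K k))).
  apply: chebyshev_prod_ratio => //.
    by rewrite ler_pdivlMr// ler_pdivrMr//; lra.
  by rewrite ler_pdivlMr//; lra.
move=> k _; have /andP[mr _] := cheb_root_itv K k (ltW mL).
have r0 : 0 < cheb_root m L K k := lt_le_trans m0 mr.
have rE : cheb_root m L K k =
    (L - m) / 2 * ((L + m) / (L - m) - cheb_node R K k).
  by rewrite /cheb_root -/(cheb_node R K k); field; rewrite gt_eqF.
have d0 : (L + m) / (L - m) - cheb_node R K k != 0.
  by move: r0; rewrite rE => /lt0r_neq0; rewrite mulf_eq0 negb_or => /andP[].
rewrite zE rE /t; move: d0; set c := cheb_node R K k => d0.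
have Lm0 : L - m != 0 by rewrite gt_eqF.
have -> : (L + m - 2 * l) / (L - m) = (L + m) / (L - m) - 2 * l / (L - m).
  by field.
move: d0; set S := (L + m) / (L - m) => d0.
by field; rewrite d0.
Qed.

(** The ratio is [1 - 2 * a / (B + a)], and [1 + x <= expR x] applies to it before taking the
    power. *)
Lemma expR_contraction (R : realType) (m L : R) (K : nat) : 0 < m -> m <= L ->
  ((Num.sqrt L - Num.sqrt m) / (Num.sqrt L + Num.sqrt m)) ^+ K <=
  expR (- (K%:R / ((Num.sqrt (L / m) + 1) / 2))).
Proof.
move=> m0 mL; have L0 := lt_le_trans m0 mL.
have sm0 : 0 < Num.sqrt m by rewrite sqrtr_gt0.
have aB : Num.sqrt m <= Num.sqrt L by rewrite ler_sqrt// ltW.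
rewrite (sqrtrM _ (ltW L0)) (sqrtrV (ltW m0)).
set a := Num.sqrt m in sm0 aB *; set B := Num.sqrt L in aB *.
have aB0 : 0 < B + a by rewrite ltr_wpDl// (le_trans (ltW sm0)).
have -> : - (K%:R / ((B / a + 1) / 2)) = - (2 * a / (B + a)) * K%:R.
  by field; rewrite !gt_eqF.
rewrite expRM_natr; apply: lerXn2r; rewrite ?nnegrE ?expR_ge0//.
  by rewrite divr_ge0 ?subr_ge0// ltW.
apply: le_trans (expR_ge1Dx _).
rewrite le_eqVlt; apply/orP; left; apply/eqP; field.
by rewrite gt_eqF.
Qed.

Lemma hamiltonian_norm2_le (R : realType) (d : nat) (A : 'M[R]_d)
    (b : 'cV[R]_d) (m L : R) (K : nat) (x : nat -> 'cV[R]_d) :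
  spd A -> lambda_min A m -> lambda_max A L -> (0 < K)%N ->
  reset_iterates (hamiltonian_flow (quadratic A b)) K (hd_time m L K) x ->
  norm2 (x K.+1 - minimizer A b) <=
  2 * ((Num.sqrt L - Num.sqrt m) / (Num.sqrt L + Num.sqrt m)) ^+ K *
  norm2 (x 1%N - minimizer A b).
Proof.
move=> spdA [evm minm] [evL maxL] K0 xP.
have m0 := spd_eigenvalue_gt0 spdA evm.
have mL : m <= L := minm _ evL.
set rho := 2 * _.
have rho0 : 0 <= rho.
  apply: mulr_ge0 => //; apply: exprn_ge0; apply: divr_ge0.
    by rewrite subr_ge0 ler_sqrt// (le_trans (ltW m0)).
  by rewrite addr_ge0 ?sqrtr_ge0.
have [l [q [qA frame]]] := symmetric_eigenframe (proj1 spdA).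
rewrite -(ler_pXn2r (n := 2))// ?nnegrE ?(mulr_ge0 rho0) ?norm2_ge0//.
rewrite exprMn !norm2_sqr -!frame mulr_sumr; apply: ler_sum => j _.
(* For a zero frame vector nothing is known about [l j], but its coordinate contributes 0 to both
   sides. *)
have [q0|q0] := eqVneq (q j) 0.
  by rewrite q0 !mul0mx !mxE expr0n mulr0.
have evl : eigenvalue A (l j) by apply/eigenvalueP; exists (q j).
have l0 := spd_eigenvalue_gt0 spdA evl.
have /(reset_iterates_prod)-/(_ _ _ _ xP) -> := fun t y z =>
  @hamiltonian_eigencoord R d A b y z (q j) (l j) t spdA l0 (qA j).
rewrite exprMn mulrC ler_wpM2r ?sqr_ge0// -[leLHS]real_normK ?num_real//.
rewrite ler_pXn2r// ?nnegrE//.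
exact: prod_cos_hd_time_le (minm _ evl) (maxL _ evl) K0.
Qed.

Lemma hd_total_time_ge (R : realType) (m L : R) (K : nat) :
  0 < m -> m <= L ->
  pi / 2 * (K%:R / Num.sqrt L) <= total_time K (hd_time m L K).
Proof.
move=> m0 mL; have L0 := lt_le_trans m0 mL.
rewrite /total_time /hd_time -mulr_sumr ler_wpM2l ?divr_ge0 ?pi_ge0//.
apply: (@le_trans _ _ (\sum_(1 <= k < K.+1) (Num.sqrt L)^-1)).
  by rewrite sumr_const_nat subSS subn0 -[in leRHS]mulr_natl.
apply: ler_sum => k _; have /andP[mr rL] := cheb_root_itv K k mL.
have r0 := lt_le_trans m0 mr.
by rewrite lef_pV2 ?posrE ?sqrtr_gt0// ler_sqrt// ltW.
Qed.

(** By the double angle formula the root is [m * (1 - s ^+ 2) + L * s ^+ 2] with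
    [s = sin (u * (pi / 2))], and Jordan's inequality gives [u <= s]. The bound averages the
    resulting estimates by [Num.sqrt m] and by [Num.sqrt L * u]. *)
Lemma sqrt_cheb_root_ge (R : realType) (m L : R) (K k : nat) :
  0 < m -> m <= L -> (1 <= k <= K)%N ->
  (Num.sqrt m + Num.sqrt L * ((k%:R - 2^-1) / K%:R)) / 2 <=
  Num.sqrt (cheb_root m L K k).
Proof.
move=> m0 mL /andP[k1 kK].
have K0 : 0 < K%:R :> R by rewrite ltr0n (leq_trans k1).
have {}k1 : 1 <= k%:R :> R by rewrite ler1n.
have {}kK : k%:R <= K%:R :> R by rewrite ler_nat.
have L0 := lt_le_trans m0 mL.
set u := (k%:R - 2^-1) / K%:R.
have u01 : 0 <= u <= 1.
  apply/andP; split; first by apply: divr_ge0; [lra|exact: ltW].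
  by rewrite ler_pdivrMr//; lra.
have /andP[mr _] := cheb_root_itv K k mL.
have Lu : L * u ^+ 2 <= cheb_root m L K k.
  rewrite /cheb_root.
  have -> : (k%:R - 2^-1) * pi / K%:R = (u * (pi / 2)) *+ 2 :> R.
    by rewrite /u mulr2n; field; rewrite gt_eqF.
  rewrite cos_mulr2n cos2sin2; set s := sin _.
  have us : u <= s := jordan_sin u01.
  have s1 : s <= 1 := sin_le1 _.
  move: u01 => /andP[u0 _].
  have h1 : 0 <= m * (1 - s ^+ 2).
    by apply: mulr_ge0; [exact: ltW|rewrite subr_ge0; nra].
  have h2 : 0 <= L * (s ^+ 2 - u ^+ 2).
    by apply: mulr_ge0; [exact: ltW|rewrite subr_ge0; nra].
  lra.
have h1 : Num.sqrt m <= Num.sqrt (cheb_root m L K k).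
  by rewrite ler_sqrt// (le_trans (ltW m0)).
have h2 : Num.sqrt L * u <= Num.sqrt (cheb_root m L K k).
  move: u01 => /andP[u0 _].
  rewrite -{1}(ger0_norm u0) -sqrtr_sqr -(sqrtrM _ (ltW L0)).
  by rewrite ler_sqrt// (le_trans (ltW m0)).
lra.
Qed.

(** A telescoping comparison with the logarithm. The factor 2 absorbs the half-integer shift,
    through [(c + 1) / 2 <= c + 2^-1]. *)
Lemma sum_inv_shift_le (R : realType) (a : R) (K : nat) : 0 < a ->
  \sum_(1 <= k < K.+1) (a + k%:R - 2^-1)^-1 <= 2 * ln (1 + K%:R / a).
Proof.
move=> a0.
have -> : ln (1 + K%:R / a) = ln (a + K%:R) - ln a.
  rewrite -ln_div ?posrE ?ltr_wpDr ?ler0n//.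
  by congr ln; field; rewrite gt_eqF.
elim: K => [|K IHK]; first by rewrite big_geq// addr0 subrr mulr0.
rewrite big_nat_recr//=.
pose c := a + K%:R; have c0 : 0 < c by rewrite ltr_wpDr ?ler0n.
have c10 : 0 < c + 1 by rewrite addr_gt0.
have step : (c + 1)^-1 <= ln (c + 1) - ln c.
  have cV : (c + 1)^-1 = 1 - c / (c + 1) by field; rewrite gt_eqF.
  have cc : 0 < c / (c + 1) by rewrite divr_gt0.
  have : ln (1 + (c / (c + 1) - 1)) <= c / (c + 1) - 1 by apply: le_ln1Dx; lra.
  by rewrite [1 + _]addrC subrK ln_div ?posrE//; lra.
have half : (a + K.+1%:R - 2^-1)^-1 <= 2 * (c + 1)^-1.
  rewrite -natr1 -[2 in leRHS]invrK -invfM.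
  have k0 : 0 <= K%:R :> R by rewrite ler0n.
  by rewrite lef_pV2 ?posrE /c; lra.
rewrite -natr1 in half *; rewrite addrA -/c in half *.
by move: IHK; rewrite -/c; lra.
Qed.

Lemma hd_total_time_le (R : realType) (m L : R) (K : nat) :
  0 < m -> m <= L -> (0 < K)%N ->
  total_time K (hd_time m L K) <=
  2 * pi * (K%:R / Num.sqrt L) * (1 + ln (L / m)).
Proof.
move=> m0 mL K0; have L0 := lt_le_trans m0 mL.
have K0R : 0 < K%:R :> R by rewrite ltr0n.
have sm0 : 0 < Num.sqrt m by rewrite sqrtr_gt0.
have sL0 : 0 < Num.sqrt L by rewrite sqrtr_gt0.
set a := Num.sqrt m in sm0 *; set B := Num.sqrt L in sL0 *.
have aB : a <= B by rewrite ler_sqrt// ltW.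
(* With this shift, [a + B * ((k%:R - 2^-1) / K%:R)] becomes [B / K%:R] times [e + k%:R - 2^-1], the
   shape of the logarithmic sum. *)
pose e := K%:R * (a / B).
have e0 : 0 < e by rewrite mulr_gt0// divr_gt0.
have sumE : total_time K (hd_time m L K) <=
    pi * (K%:R / B) * \sum_(1 <= k < K.+1) (e + k%:R - 2^-1)^-1.
  rewrite /total_time mulr_sumr.
  rewrite [leLHS]big_nat_cond [leRHS]big_nat_cond.
  apply: ler_sum => k; rewrite andbT ltnS => kK.
  have := sqrt_cheb_root_ge m0 mL kK; rewrite -/a -/B /hd_time.
  have k1 : 1 <= k%:R :> R by rewrite ler1n; case/andP: kK.
  set u := e + k%:R - 2^-1; have u0 : 0 < u by rewrite /u; lra.
  have -> : (a + B * ((k%:R - 2^-1) / K%:R)) / 2 = (B / K%:R) * u / 2.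
    by rewrite /u /e; field; rewrite !gt_eqF.
  have v0 : 0 < (B / K%:R) * u / 2.
    by apply: divr_gt0 => //; apply: mulr_gt0 => //; exact: divr_gt0.
  move=> h; have r0 := lt_le_trans v0 h.
  have -> : pi * (K%:R / B) * u^-1 = pi / 2 * ((B / K%:R) * u / 2)^-1.
    by field; rewrite !gt_eqF.
  by rewrite ler_pM2l ?divr_gt0 ?pi_gt0// lef_pV2 ?posrE.
apply: le_trans sumE _.
(* With [s] the square root of [L / m], this is [1 + s <= 2 * s ^+ 2 <= expR 1 * s ^+ 2] after
   taking logarithms. *)
have lnE : ln (1 + K%:R / e) <= 1 + ln (L / m).
  have -> : K%:R / e = B / a by rewrite /e; field; rewrite !gt_eqF.
  have -> : L / m = (B / a) ^+ 2 by rewrite expr_div_n !sqr_sqrtr// ltW.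
  set s := B / a; have s1 : 1 <= s by rewrite ler_pdivlMr// mul1r.
  have s0 : 0 < s := lt_le_trans ltr01 s1.
  have -> : 1 + ln (s ^+ 2) = ln (expR 1 * s ^+ 2).
    by rewrite lnM ?posrE ?expR_gt0 ?exprn_gt0// expRK.
  have s10 : 0 < 1 + s by rewrite addr_gt0.
  have es0 : 0 < expR 1 * s ^+ 2 by rewrite mulr_gt0 ?expR_gt0 ?exprn_gt0.
  rewrite ler_ln ?posrE//.
  have e2 : 2 <= expR 1 :> R by have := expR_ge1Dx (1 : R); lra.
  by apply: le_trans (ler_wpM2r (sqr_ge0 s) e2); nra.
have := sum_inv_shift_le K e0.
have c0 : 0 <= pi * (K%:R / B) by rewrite mulr_ge0 ?pi_ge0// divr_ge0 ?ltW.
move=> h; apply: le_trans (ler_wpM2l c0 h) _.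
have -> : 2 * pi * (K%:R / B) * (1 + ln (L / m)) =
    pi * (K%:R / B) * (2 * (1 + ln (L / m))) by ring.
by apply: ler_wpM2l => //; exact: ler_wpM2l.
Qed.

(** * Assembly of the two time bounds *)

Lemma heavy_ball_lower_bound (R : realType) (d : nat) (A : 'M[R]_d)
    (b : 'cV[R]_d) (m dist : R) : spd A -> lambda_min A m -> 0 < dist ->
  exists x1 : 'cV[R]_d,
    norm2 (x1 - minimizer A b) = dist /\
    forall (eps : R) (K : nat) (eta : nat -> R) (x : nat -> 'cV[R]_d),
    0 < eps ->
    (forall k, (1 <= k <= K)%N -> 0 <= eta k) ->
    x 1%N = x1 ->
    reset_iterates (heavy_ball_flow m (quadratic A b)) K eta x ->
    norm2 (x K.+1 - minimizer A b) <= eps ->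
    (Num.sqrt m)^-1 * ln (norm2 (x1 - minimizer A b) / eps)
      <= total_time K eta.
Proof.
move=> spdA [evm _] dist0.
have [q [q1 qA]] := unit_eigenvector evm.
have nE : norm2 (minimizer A b + dist *: q - minimizer A b) = dist.
  rewrite addrC addKr; apply/eqP.
  rewrite -(eqrXn2 (n := 2))// ?norm2_ge0 ?ltW// norm2_sqr.
  under eq_bigr do rewrite mxE exprMn.
  by rewrite -mulr_sumr -norm2_sqr q1 expr1n mulr1.
(* The error starts entirely along the slowest eigendirection. This point is fixed before the
   accuracy and the schedule, so it defeats all of them at once. *)
exists (minimizer A b + dist *: q); split=> //.
move=> eps K eta x eps0 eta0 x1E xP xeps; rewrite nE.
exact: (heavy_ball_total_time spdA (spd_eigenvalue_gt0 spdA evm) q1 qA) xeps.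
Qed.

(** Up to a factor 2, [K] is the square root of [L / m] times the logarithm, with a further factor
    between 1/2 and 1; dividing by [Num.sqrt L] turns this into the scale [(Num.sqrt m)^-1]. *)
Lemma hamiltonian_descent_bounds (R : realType) (d : nat) (A : 'M[R]_d)
    (b x1 : 'cV[R]_d) (m L eps : R) (K : nat) :
  spd A -> lambda_min A m -> lambda_max A L -> 0 < eps ->
  K%:Z = Num.ceil (hd_iterations (L / m) (norm2 (x1 - minimizer A b)) eps) ->
  (2 <= K)%N ->
  [/\ forall x : nat -> 'cV[R]_d,
        x 1%N = x1 ->
        reset_iterates (hamiltonian_flow (quadratic A b)) K (hd_time m L K) x ->
        norm2 (x K.+1 - minimizer A b) <= eps,
      pi / 4 * ((Num.sqrt m)^-1 * ln (2 * norm2 (x1 - minimizer A b) / eps))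
        <= total_time K (hd_time m L K)
    & total_time K (hd_time m L K)
        <= 4 * pi * (1 + ln (L / m)) *
           ((Num.sqrt m)^-1 * ln (2 * norm2 (x1 - minimizer A b) / eps))].
Proof.
move=> spdA minA maxA eps0 KE K2.
have m0 := spd_eigenvalue_gt0 spdA minA.1.
have mL : m <= L := minA.2 _ maxA.1.
have L0 := lt_le_trans m0 mL.
have K0 : (0 < K)%N := ltnW K2.
have sm0 : 0 < Num.sqrt m by rewrite sqrtr_gt0.
have sL0 : 0 < Num.sqrt L by rewrite sqrtr_gt0.
have smL : Num.sqrt m <= Num.sqrt L by rewrite ler_sqrt// ltW.
have sE : Num.sqrt (L / m) = Num.sqrt L / Num.sqrt m.
  by rewrite (sqrtrM _ (ltW L0)) (sqrtrV (ltW m0)).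
set dist := norm2 _ in KE *; set l := ln _.
set N := hd_iterations _ _ _ in KE.
have NE : N = (Num.sqrt L / Num.sqrt m + 1) / 2 * l.
  by rewrite /N /hd_iterations sE.
have /andP[KN NK] := ceil_itv N; rewrite -KE in KN NK.
have {}NK : N <= K%:R by [].
have {}KN : K%:R - 1 < N by move: KN; rewrite intrB.
have K2R : 2 <= K%:R :> R by rewrite ler_nat.
(* Since [2 <= K], rounding [N] up to [K] costs at most a factor 2. *)
have KN2 : K%:R <= 2 * N by lra.
have kap1 : 1 <= Num.sqrt L / Num.sqrt m by rewrite ler_pdivlMr// mul1r.
have k0 : 0 < (Num.sqrt L / Num.sqrt m + 1) / 2 by lra.
(* Two iterations or more force the unrounded count above 1, hence a positive logarithm. *)
have l0 : 0 < l by rewrite -(pmulr_rgt0 _ k0) -NE; lra.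
split.
- move=> x x1E xP.
  apply: le_trans (hamiltonian_norm2_le spdA minA maxA K0 xP) _.
  rewrite x1E -/dist.
  (* At distance 0 the logarithm would take its default value 0, against [l0]. *)
  have dist0 : 0 < dist.
    rewrite lt0r norm2_ge0 andbT; apply/eqP => d0.
    by move: l0; rewrite /l d0 mulr0 mul0r ln0// ltxx.
  have Nl : l <= K%:R / ((Num.sqrt (L / m) + 1) / 2).
    by rewrite sE ler_pdivlMr// mulrC -NE.
  have h : expR (- (K%:R / ((Num.sqrt (L / m) + 1) / 2))) <= eps / (2 * dist).
    apply: le_trans (_ : expR (- l) <= _); first by rewrite ler_expR lerN2.
    by rewrite expRN /l lnK ?posrE ?divr_gt0 ?mulr_gt0// invf_div.
  have := le_trans (expR_contraction K m0 mL) h.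
  by rewrite ler_pdivlMr ?mulr_gt0// => h'; rewrite mulrAC mulrC.
- apply: le_trans (hd_total_time_ge K m0 mL).
  have -> : pi / 4 * ((Num.sqrt m)^-1 * l) =
      pi / 2 * ((Num.sqrt L / Num.sqrt m / 2 * l) / Num.sqrt L).
    by field; rewrite !gt_eqF.
  apply: ler_wpM2l; first by rewrite divr_ge0 ?pi_ge0.
  rewrite ler_pM2r ?invr_gt0//; apply: le_trans NK; rewrite NE.
  by apply: ler_wpM2r; [exact: ltW|lra].
- apply: le_trans (hd_total_time_le m0 mL K0) _.
  have lk0 : 0 <= 1 + ln (L / m).
    by rewrite addr_ge0// ln_ge0// ler_pdivlMr// mul1r.
  rewrite [leRHS]mulrAC; apply: ler_wpM2r => //.
  (* One factor 2 of the constant comes from rounding up [N]; the count itself is at most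
     [Num.sqrt L / Num.sqrt m * l] because that quotient of roots is at least 1. *)
  have -> : 4 * pi * ((Num.sqrt m)^-1 * l) =
      2 * pi * ((2 * (Num.sqrt L / Num.sqrt m * l)) / Num.sqrt L).
    by field; rewrite !gt_eqF.
  apply: ler_wpM2l; first by rewrite mulr_ge0 ?pi_ge0.
  rewrite ler_pM2r ?invr_gt0//; apply: le_trans KN2 _; rewrite NE.
  apply: ler_wpM2l => //; apply: ler_wpM2r; [exact: ltW|lra].
Qed.

(** The constants precede the dimension and the matrix, hence are absolute; the condition number
    enters the upper bound, beyond the scale [(Num.sqrt m)^-1], only through [1 + ln (L / m)]. *)
Theorem theorem2 (R : realType) :
  (exists c : R, 0 < c /\
    forall (d : nat) (A : 'M[R]_d) (b : 'cV[R]_d) (m : R),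
    spd A -> lambda_min A m ->
    forall dist : R, 0 < dist ->
    exists x1 : 'cV[R]_d,
      norm2 (x1 - minimizer A b) = dist /\
      forall (eps : R) (K : nat) (eta : nat -> R) (x : nat -> 'cV[R]_d),
      0 < eps ->
      (forall k, (1 <= k <= K)%N -> 0 <= eta k) ->
      x 1%N = x1 ->
      reset_iterates (heavy_ball_flow m (quadratic A b)) K eta x ->
      norm2 (x K.+1 - minimizer A b) <= eps ->
      c * ((Num.sqrt m)^-1 * ln (norm2 (x1 - minimizer A b) / eps))
        <= total_time K eta)
  /\
  (exists c C : R, 0 < c /\ 0 < C /\
    forall (d : nat) (A : 'M[R]_d) (b : 'cV[R]_d) (m L : R),
    spd A -> lambda_min A m -> lambda_max A L ->
    exists K0 : nat,
      forall (x1 : 'cV[R]_d) (eps : R) (K : nat),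
      0 < eps ->
      K%:Z = Num.ceil
               (hd_iterations (L / m) (norm2 (x1 - minimizer A b)) eps) ->
      (K0 <= K)%N ->
      [/\ forall x : nat -> 'cV[R]_d,
            x 1%N = x1 ->
            reset_iterates (hamiltonian_flow (quadratic A b)) K
              (hd_time m L K) x ->
            norm2 (x K.+1 - minimizer A b) <= eps,
          c * ((Num.sqrt m)^-1 * ln (2 * norm2 (x1 - minimizer A b) / eps))
            <= total_time K (hd_time m L K)
        & total_time K (hd_time m L K)
            <= C * (1 + ln (L / m)) *
               ((Num.sqrt m)^-1 *
                ln (2 * norm2 (x1 - minimizer A b) / eps))]).
Proof.
split.
  exists 1; split=> // d A b m spdA minA dist dist0.
  have [x1 [x1E x1P]] := heavy_ball_lower_bound b spdA minA dist0.
  by exists x1; split=> // eps K eta x; rewrite mul1r; exact: x1P.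
exists (pi / 4), (4 * pi); split; first by rewrite divr_gt0 ?pi_gt0.
split; first by rewrite mulr_gt0 ?pi_gt0.
(* The threshold 2 serves every matrix: it is what makes rounding up the iteration count cost at
   most a factor 2. *)
move=> d A b m L spdA minA maxA; exists 2%N => x1 eps K eps0 KE K2.
exact: hamiltonian_descent_bounds.
Qed.
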